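(* Let $(M,\varphi,\xi,\eta,g)$ be a $3$-dimensional trans-Sasakian manifold of type $(\alpha,\beta)$ equipped with a Newman--Penrose frame $(\partial,\overline{\partial},\xi)$. Then the following are equivalent: (a) the vector field $\xi$ is divergence-free; (b) the congruence generated by $\xi$ is non-expanding; (c) $M$ is a $\mathcal{C}_6$-manifold.
   Context: An almost contact metric structure $(\varphi,\xi,\eta,g)$ on $M$: $\varphi$ a $(1,1)$-tensor, $\xi$ a vector field, $\eta$ a $1$-form, $g$ a Riemannian metric with $\varphi^2=-I+\eta\otimes\xi$, $\eta(\xi)=1$, $\varphi\xi=0$, $\eta\circ\varphi=0$, $g(\varphi X,\varphi Y)=g(X,Y)-\eta(X)\eta(Y)$. It is trans-Sasakian of type $(\alpha,\beta)$ ($\alpha,\beta$ smooth functions) if $(\nabla_X\varphi)Y=\alpha(g(X,Y)\xi-\eta(Y)X)+\beta(g(\varphi X,Y)\xi-\eta(Y)\varphi X)$, with $\nabla$ the Levi-Civita connection. A trans-Sasakian manifold of type $(\alpha,\beta)$ is a $\mathcal{C}_6$-manifold if $\beta=0$. Newman--Penrose frame: for an orthonormal frame $(e_1,e_2,\xi)$, $\partial=\frac1{\sqrt2}(e_1-ie_2)$, $\overline{\partial}=\frac1{\sqrt2}(e_1+ie_2)$, chosen so that $\varphi\partial=i\partial$, $\varphi\overline{\partial}=-i\overline{\partial}$ (i.e. $\varphi e_1=e_2$). Put $\rho_{\mathrm{np}}=g(\partial,\nabla_{\overline{\partial}}\xi)=\Theta_{\mathrm{np}}+i\omega_{\mathrm{np}}$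 (complex-bilinear extension of $g$), with $\Theta_{\mathrm{np}}$ (expansion) and $\omega_{\mathrm{np}}$ (twist) real. With also $\sigma_{\mathrm{np}}=-g(\partial,\nabla_\partial\xi)$ and $\kappa_{\mathrm{np}}=-g(\partial,\nabla_\xi\xi)$, the trans-Sasakian condition of type $(\alpha,\beta)$ reads $\kappa_{\mathrm{np}}=\sigma_{\mathrm{np}}=0$, $\rho_{\mathrm{np}}=\beta+i\alpha$. The congruence generated by $\xi$ is non-expanding if $\Theta_{\mathrm{np}}=0$. The divergence is $\operatorname{div}(X)=\sum_{i=1}^3g(\nabla_{e_i}X,e_i)$ for a local orthonormal frame. *)

(* Defs.v *)
From HB Require Import structures.
From mathcomp Require Import all_boot all_order all_algebra.
From mathcomp Require Import all_classical all_reals all_analysis.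
From mathcomp Require Import complex.
Set Implicit Arguments.
Unset Strict Implicit.
Unset Printing Implicit Defensive.
Import Order.TTheory GRing.Theory Num.Theory.
Import numFieldNormedType.Exports.
Local Open Scope classical_set_scope.
Local Open Scope ring_scope.

Section Smooth.
Variables (R : realType) (V W : normedModType R).

(* Meant for open [A]: the base case is continuity at the points of [A], not
   continuity of the restriction to [A]. *)
Fixpoint Ck_on (k : nat) (A : set V) (f : V -> W) : Prop :=
  if k is k'.+1 then
    (forall x, A x -> differentiable f x) /\
    (forall v, Ck_on k' A (fun x => 'd f x v))
  else forall x, A x -> {for x, continuous f}.

Definition smooth_on (A : set V) (f : V -> W) := forall k, Ck_on k A f.

End Smooth.

(* [chart_inv] is only meaningful on the image of [chart_dom]. *)
Record chart (R : realType) (n : nat) (M : topologicalType) := Chart {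
  chart_dom : set M;
  chart_map : M -> 'rV[R]_n;
  chart_inv : 'rV[R]_n -> M;
  chart_dom_open : open chart_dom;
  chart_img_open : open (chart_map @` chart_dom);
  chart_mapK : forall p, chart_dom p -> chart_inv (chart_map p) = p;
  chart_map_continuous : forall p, chart_dom p -> {for p, continuous chart_map};
  chart_inv_continuous : forall x, (chart_map @` chart_dom) x ->
    {for x, continuous chart_inv} }.

(* The atlas need not be maximal. As in Lean's mathlib, each point carries a
   preferred chart [chart_at p] containing it, through which its tangent space
   is identified with R^n. *)
Record smooth_manifold (R : realType) (n : nat) := SmoothManifold {
  man_space :> topologicalType;
  man_hausdorff : hausdorff_space man_space;
  man_second_countable : @second_countable man_space;
  atlas_index : Type;
  atlas : atlas_index -> chart R n man_space;
  chart_at : man_space -> atlas_index;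
  chart_at_dom : forall p, chart_dom (atlas (chart_at p)) p;
  transition_smooth : forall i j,
    smooth_on
      (chart_map (atlas i) @` (chart_dom (atlas i) `&` chart_dom (atlas j)))
      (chart_map (atlas j) \o chart_inv (atlas i)) }.

Section Manifold.
Variables (R : realType) (n : nat) (M : smooth_manifold R n).

Local Notation E := ('rV[R]_n).
Local Notation dom i := (chart_dom (atlas (i : atlas_index M))).
Local Notation to i := (chart_map (atlas (i : atlas_index M))).
Local Notation from i := (chart_inv (atlas (i : atlas_index M))).

(* The coordinates of a tangent vector at [p] are those in the chart
   [chart_at p]; hence tangent vectors at different points, although of
   convertible types, are in general expressed in unrelated coordinates. *)
Definition tangent (p : M) : lmodType R := E.

Definition vfield := forall p : M, tangent p.

Definition smooth_fun_on (U : set M) (f : M -> R) :=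
  forall i, smooth_on (to i @` (dom i `&` U)) (f \o from i).

Definition smooth_fun (f : M -> R) := smooth_fun_on setT f.

Definition dfun (f : M -> R) (p : M) (v : tangent p) : R :=
  'd (f \o from (chart_at p)) (to (chart_at p) p) v.

(* The components of a tangent vector in an arbitrary chart [i] at [p], and
   conversely the tangent vector with given components in the chart [i]. *)
Definition tcoord (i : atlas_index M) (p : M) (v : tangent p) : E :=
  'd (to i \o from (chart_at p)) (to (chart_at p) p) v.

Definition tvec (i : atlas_index M) (p : M) (w : E) : tangent p :=
  'd (to (chart_at p) \o from i) (to i p) w.

(* The expression of a vector field in the chart [i], as a function of the
   coordinates. *)
Definition vcoord (i : atlas_index M) (X : vfield) (x : E) : E :=
  tcoord i (X (from i x)).

Definition smooth_vfield_on (U : set M) (X : vfield) :=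
  forall i, smooth_on (to i @` (dom i `&` U)) (vcoord i X).

Definition smooth_vfield (X : vfield) := smooth_vfield_on setT X.

(* [X, Y] = DY(X) - DX(Y), computed in the preferred chart at the point. *)
Definition lie_bracket (X Y : vfield) : vfield := fun p =>
  let i := chart_at p in
  'd (vcoord i Y) (to i p) (X p) - 'd (vcoord i X) (to i p) (Y p).

(* A tensor field is smooth if its components with respect to the coordinate
   vector fields [tvec i _ w] of every chart are. *)
Record riemannian_metric := RiemannianMetric {
  metric :> forall p : M, {biscalar tangent p};
  metric_sym : forall p (u v : tangent p), metric p u v = metric p v u;
  metric_pos : forall p (v : tangent p), v != 0 -> 0 < metric p v v;
  metric_smooth : forall i (w w' : E),
    smooth_fun_on (dom i) (fun p => metric p (tvec i p w) (tvec i p w')) }.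

(* [nabla p v Y] is the covariant derivative of Y at p in the direction v,
   so (nabla_X Y)_p is [nabla p (X p) Y]; its value is only constrained for
   smooth Y. *)
Definition covderiv := forall p : M, tangent p -> vfield -> tangent p.

Definition nabla_field (nabla : covderiv) (X Y : vfield) : vfield :=
  fun p => nabla p (X p) Y.

Record affine_connection (nabla : covderiv) : Prop := AffineConnection {
  conn_smooth : forall X Y, smooth_vfield X -> smooth_vfield Y ->
    smooth_vfield (nabla_field nabla X Y);
  conn_linear : forall Y, smooth_vfield Y ->
    forall p (a : R) (u v : tangent p),
      nabla p (a *: u + v) Y = a *: nabla p u Y + nabla p v Y;
  conn_add : forall Y Z, smooth_vfield Y -> smooth_vfield Z ->
    forall p (v : tangent p),
      nabla p v (fun q => Y q + Z q) = nabla p v Y + nabla p v Z;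
  conn_leibniz : forall f Y, smooth_fun f -> smooth_vfield Y ->
    forall p (v : tangent p),
      nabla p v (fun q => f q *: Y q) = dfun f v *: Y p + f p *: nabla p v Y }.

Record levi_civita (g : riemannian_metric) (nabla : covderiv) : Prop :=
  LeviCivita {
  lc_connection : affine_connection nabla;
  lc_torsion_free : forall X Y, smooth_vfield X -> smooth_vfield Y ->
    forall p, nabla_field nabla X Y p - nabla_field nabla Y X p
              = lie_bracket X Y p;
  lc_metric : forall X Y Z,
    smooth_vfield X -> smooth_vfield Y -> smooth_vfield Z ->
    forall p, dfun (fun q => g q (Y q) (Z q)) (X p)
              = g p (nabla_field nabla X Y p) (Z p)
                + g p (Y p) (nabla_field nabla X Z p) }.

Definition orthonormal_frame_on (g : riemannian_metric) (U : set M)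
    (e : 'I_n -> vfield) :=
  (forall i, smooth_vfield_on U (e i)) /\
  (forall p, U p -> forall i j, g p (e i p) (e j p) = (i == j)%:R).

(* The value does not depend on the orthonormal frame; rather than choosing
   frames, [divergence_free] below quantifies over all local ones. *)
Definition divergence (g : riemannian_metric) (nabla : covderiv)
    (e : 'I_n -> vfield) (X : vfield) (p : M) : R :=
  \sum_i g p (nabla p (e i p) X) (e i p).

Definition divergence_free (g : riemannian_metric) (nabla : covderiv)
    (X : vfield) :=
  forall (U : set M) (e : 'I_n -> vfield),
    open U -> orthonormal_frame_on g U e ->
    forall p, U p -> divergence g nabla e X p = 0.

Record almost_contact_metric := AlmostContactMetric {
  acm_phi : forall p : M, {linear tangent p -> tangent p};
  acm_xi : vfield;
  acm_eta : forall p : M, {scalar tangent p};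
  acm_metric : riemannian_metric;
  acm_phi_smooth : forall i (w : E),
    smooth_vfield_on (dom i) (fun p => acm_phi p (tvec i p w));
  acm_xi_smooth : smooth_vfield acm_xi;
  acm_eta_smooth : forall i (w : E),
    smooth_fun_on (dom i) (fun p => acm_eta p (tvec i p w));
  acm_phi_phi : forall p (v : tangent p),
    acm_phi p (acm_phi p v) = - v + acm_eta p v *: acm_xi p;
  acm_eta_xi : forall p, acm_eta p (acm_xi p) = 1;
  acm_phi_xi : forall p, acm_phi p (acm_xi p) = 0;
  acm_eta_phi : forall p (v : tangent p), acm_eta p (acm_phi p v) = 0;
  acm_metric_phi : forall p (u v : tangent p),
    acm_metric p (acm_phi p u) (acm_phi p v)
    = acm_metric p u v - acm_eta p u * acm_eta p v }.

(* (nabla_X phi) Y *)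
Definition nabla_phi (S : almost_contact_metric) (nabla : covderiv)
    (X Y : vfield) : vfield := fun p =>
  nabla_field nabla X (fun q => acm_phi S q (Y q)) p
  - acm_phi S p (nabla_field nabla X Y p).

Definition trans_sasakian (S : almost_contact_metric) (nabla : covderiv)
    (alpha beta : M -> R) : Prop :=
  [/\ smooth_fun alpha, smooth_fun beta &
      forall X Y, smooth_vfield X -> smooth_vfield Y -> forall p,
        nabla_phi S nabla X Y p
        = alpha p *: (acm_metric S p (X p) (Y p) *: acm_xi S p
                      - acm_eta S p (Y p) *: X p)
          + beta p *: (acm_metric S p (acm_phi S p (X p)) (Y p) *: acm_xi S p
                       - acm_eta S p (Y p) *: acm_phi S p (X p))].

Definition C6_manifold (S : almost_contact_metric) (nabla : covderiv)
    (alpha beta : M -> R) : Prop :=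
  trans_sasakian S nabla alpha beta /\ (forall p, beta p = 0).

(* The complexified tangent space: the pair (u, v) stands for u + i v. *)
Definition ctangent (p : M) : lmodType R := (tangent p * tangent p)%type.

Definition cvec p (v : tangent p) : ctangent p := (v, 0).

Definition cscale p (a : R[i]) (z : ctangent p) : ctangent p :=
  (complex.Re a *: z.1 - complex.Im a *: z.2,
   complex.Re a *: z.2 + complex.Im a *: z.1).

(* Complex-linear, resp. complex-bilinear, extensions. *)
Definition cphi (S : almost_contact_metric) p (z : ctangent p) : ctangent p :=
  (acm_phi S p z.1, acm_phi S p z.2).

Definition cnabla (nabla : covderiv) p (z : ctangent p) (X : vfield) :
  ctangent p := (nabla p z.1 X, nabla p z.2 X).

Definition cmetric (g : riemannian_metric) p (z w : ctangent p) : R[i] :=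
  Complex (g p z.1 w.1 - g p z.2 w.2) (g p z.1 w.2 + g p z.2 w.1).

Definition np_d (e1 e2 : vfield) (p : M) : ctangent p :=
  cscale ((Num.sqrt 2)^-1)%:C%C (cvec (e1 p) - cscale 'i%C (cvec (e2 p))).

Definition np_dbar (e1 e2 : vfield) (p : M) : ctangent p :=
  cscale ((Num.sqrt 2)^-1)%:C%C (cvec (e1 p) + cscale 'i%C (cvec (e2 p))).

Definition np_rho (S : almost_contact_metric) (nabla : covderiv)
    (e1 e2 : vfield) (p : M) : R[i] :=
  cmetric (acm_metric S) (np_d e1 e2 p)
    (cnabla nabla (np_dbar e1 e2 p) (acm_xi S)).

Definition np_expansion (S : almost_contact_metric) (nabla : covderiv)
    (e1 e2 : vfield) (p : M) : R := complex.Re (np_rho S nabla e1 e2 p).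

Definition non_expanding (S : almost_contact_metric) (nabla : covderiv)
    (e1 e2 : vfield) : Prop := forall p, np_expansion S nabla e1 e2 p = 0.

End Manifold.

(* The Newman-Penrose frame determined by the orthonormal frame
   (e1, e2, xi), given by its real members e1 and e2. *)
Record np_frame (R : realType) (M : smooth_manifold R 3)
    (S : almost_contact_metric M) (e1 e2 : vfield M) : Prop := NPFrame {
  np_orthonormal : orthonormal_frame_on (acm_metric S) setT
    (fun i => tnth [tuple e1; e2; acm_xi S] i);
  np_phi_d : forall p,
    cphi S (np_d e1 e2 p) = cscale 'i%C (np_d e1 e2 p);
  np_phi_dbar : forall p,
    cphi S (np_dbar e1 e2 p) = cscale (- 'i%C) (np_dbar e1 e2 p) }.

(* Main.v *)
Require Import Defs.
From mathcomp Require Import all_boot all_order all_algebra.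
From mathcomp Require Import all_classical all_reals all_analysis.
From mathcomp Require Import complex ring.
Set Implicit Arguments.
Unset Strict Implicit.
Unset Printing Implicit Defensive.
Import Order.TTheory GRing.Theory Num.Theory.
Import numFieldNormedType.Exports.
Local Open Scope ring_scope.

(** Putting Y = xi in the trans-Sasakian condition and applying phi gives
    nabla_X xi = - alpha phi X + beta (X - eta(X) xi).  As phi is
    skew-symmetric, in the frame (e1, e2, xi) the divergence of xi is 2 beta and
    the expansion is beta, so each of them vanishes exactly when beta does. *)

Lemma smooth_on_cst (R : realType) (V W : normedModType R) (A : set V) (c : W) :
  smooth_on A (fun _ : V => c).
Proof.
move=> k; elim: k c => [|k IHk] c /=; first by move=> x _; exact: cst_continuous.
split=> [x _|v]; first exact: differentiable_cst.
rewrite (_ : (fun x => _) = fun=> 0); first exact: IHk.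
by apply/funext => x; rewrite (diff_cst c x).
Qed.

Lemma smooth_vfield0 (R : realType) n (M : smooth_manifold R n) :
  smooth_vfield (fun p : M => 0 : tangent p).
Proof.
move=> i; rewrite (_ : vcoord _ _ = fun=> 0); first exact: smooth_on_cst.
by apply/funext => x; rewrite /vcoord /tcoord linear0.
Qed.

(** Additivity on 0 + 0 = 0 forces this. It disposes of the term [nabla_X (phi xi)] once
    [phi xi = 0] is known. *)
Lemma nabla_vfield0 (R : realType) n (M : smooth_manifold R n)
    (nabla : covderiv M) (hnabla : affine_connection nabla) p (v : tangent p) :
  nabla p v (fun q => 0 : tangent q) = 0.
Proof.
have s0 := @smooth_vfield0 _ _ M.
have /= := conn_add hnabla s0 s0 v.
rewrite (_ : (fun q => 0 + 0) = fun q : M => 0 : tangent q); last first.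
  by apply: functional_extensionality_dep => q; rewrite addr0.
by move/eqP; rewrite -subr_eq0 opprD addrA subrr sub0r oppr_eq0 => /eqP.
Qed.

Lemma nabla_tangent0 (R : realType) n (M : smooth_manifold R n)
    (nabla : covderiv M) (hnabla : affine_connection nabla)
    (Y : vfield M) (sY : smooth_vfield Y) p :
  nabla p 0 Y = 0.
Proof.
have := conn_linear hnabla sY 1 (0 : tangent p) 0.
rewrite !scale1r addr0 => /eqP.
by rewrite -subr_eq0 opprD addrA subrr sub0r oppr_eq0 => /eqP.
Qed.

(** Differentiating the constant g(Y, Y) along X by metric compatibility gives 0 as twice this
    product. *)
Lemma metric_nabla_unit (R : realType) n (M : smooth_manifold R n)
    (g : riemannian_metric M) (nabla : covderiv M) (hnabla : levi_civita g nabla)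
    (X Y : vfield M) (sX : smooth_vfield X) (sY : smooth_vfield Y)
    (Y1 : forall q, g q (Y q) (Y q) = 1) p :
  g p (nabla p (X p) Y) (Y p) = 0.
Proof.
have := lc_metric hnabla sX sY sY p.
rewrite (_ : (fun q => _) = fun=> 1); last by apply/funext.
rewrite /dfun (_ : _ \o _ = cst 1)// diff_cst /nabla_field.
rewrite (Defs.metric_sym g (Y p)) -mulr2n => /esym/eqP.
by rewrite mulrn_eq0 => /eqP.
Qed.

(** The square matrix with rows [u i] has trivial left kernel, because pairing a relation with [u j]
    isolates its j-th coefficient; hence it is invertible, and the coefficients of [v] are the
    entries of [v *m invmx A]. *)
Lemma orthonormal_span (R : realType) n (M : smooth_manifold R n)
    (g : riemannian_metric M) p (u : 'I_n -> tangent p)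
    (u_on : forall i j, g p (u i) (u j) = (i == j)%:R) (v : tangent p) :
  exists c : 'I_n -> R, v = \sum_i c i *: u i.
Proof.
pose A : 'M[R]_n := \matrix_i (u i : 'rV[R]_n).
have mulA (w : 'rV[R]_n) : w *m A = \sum_i w 0 i *: (u i : 'rV[R]_n).
  by rewrite mulmx_sum_row; apply: eq_bigr => i _; rewrite rowK.
have Afree : row_free A.
  apply: inj_row_free => w; rewrite mulA => w0; apply/rowP => j; rewrite mxE.
  have := congr1 (fun x : tangent p => g p x (u j)) w0.
  rewrite linear0l linear_sumlz (bigD1 j)//= big1 ?addr0 => [|i ij].
    by rewrite linearZl_LR u_on eqxx mulr1.
  by rewrite linearZl_LR u_on (negbTE ij) mulr0.
exists (fun i => ((v : 'rV[R]_n) *m invmx A) 0 i).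
by rewrite -[RHS]mulA mulmxKV // -row_free_unit.
Qed.

Section AlmostContact.
Variables (R : realType) (n : nat) (M : smooth_manifold R n).
Variable S : almost_contact_metric M.
Local Notation g := (acm_metric S).
Local Notation phi := (acm_phi S).
Local Notation xi := (acm_xi S).
Local Notation eta := (acm_eta S).

Lemma metric_xi p (v : tangent p) : g p v (xi p) = eta p v.
Proof.
have := acm_metric_phi S v (xi p).
rewrite acm_phi_xi linear0r acm_eta_xi mulr1.
by move/eqP; rewrite eq_sym subr_eq0 => /eqP.
Qed.

(** Compatibility of g with phi at the pair (phi v, v), where eta(phi v) = 0 and phi^2 v = - v +
    eta(v) xi, shows that this number equals its own negative. *)
Lemma metric_phi_self p (v : tangent p) : g p (phi p v) v = 0.
Proof.
have := acm_metric_phi S (phi p v) v.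
rewrite acm_eta_phi mul0r subr0 acm_phi_phi linearDl linearNl linearZl_LR.
rewrite (Defs.metric_sym g (xi p)) metric_xi acm_eta_phi mulr0 addr0 (Defs.metric_sym g v).
by move/esym/eqP; rewrite -addr_eq0 -mulr2n mulrn_eq0 => /eqP.
Qed.

Lemma nabla_xi (nabla : covderiv M)
    (hnabla : levi_civita g nabla)
    (alpha beta : M -> R) (htS : trans_sasakian S nabla alpha beta)
    (X : vfield M) (sX : smooth_vfield X) p :
  nabla p (X p) xi
  = - alpha p *: phi p (X p) + beta p *: (X p - eta p (X p) *: xi p).
Proof.
have sxi := acm_xi_smooth S.
(* As xi has unit length, its derivative is orthogonal to xi, so phi^2 acts on it as - id. *)
have eta0 : eta p (nabla p (X p) xi) = 0.
  rewrite -metric_xi; apply: (metric_nabla_unit hnabla sX sxi) => q.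
  by rewrite metric_xi acm_eta_xi.
have [_ _ /(_ X xi sX sxi p)] := htS.
rewrite /nabla_phi /nabla_field.
rewrite (_ : (fun q => phi q (xi q)) = fun q : M => 0 : tangent q); last first.
  by apply: functional_extensionality_dep => q; exact: acm_phi_xi.
rewrite (nabla_vfield0 (lc_connection hnabla)) sub0r.
rewrite !metric_xi acm_eta_phi acm_eta_xi !scale1r scale0r sub0r.
move/(congr1 (phi p)).
rewrite linearN acm_phi_phi eta0 scale0r addr0 opprK => ->.
rewrite linearD !linearZ /= linearB linearZ /= acm_phi_xi scaler0 sub0r.
by rewrite [phi p (- _)]linearN acm_phi_phi opprD opprK !scalerN scaleNr.
Qed.

(** The previous formula concerns values of global smooth fields. The global frame expresses every
    tangent vector through such values, and both sides are linear in [v]. *)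
Lemma nabla_xi_tangent (nabla : covderiv M)
    (hnabla : levi_civita g nabla)
    (alpha beta : M -> R) (htS : trans_sasakian S nabla alpha beta)
    (e : 'I_n -> vfield M)
    (he : orthonormal_frame_on g setT e) p (v : tangent p) :
  nabla p v xi = - alpha p *: phi p v + beta p *: (v - eta p v *: xi p).
Proof.
have [es eo] := he.
have [c ->] := orthonormal_span (eo p I) v.
have nablaP := conn_linear (lc_connection hnabla) (acm_xi_smooth S).
have nabla0 := nabla_tangent0 (lc_connection hnabla) (acm_xi_smooth S) p.
(* Induction on the list behind the sum matches the shape [a *: u + v] of [conn_linear]; the empty
   sum is settled by [nabla0]. *)
elim: (index_enum _) => [|i s IHs].
  by rewrite big_nil !linear0 scale0r subrr !scaler0 addr0.
rewrite big_cons nablaP IHs (nabla_xi hnabla htS (es i)).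
rewrite !linearD !linearZ /=.
by apply/rowP => j; rewrite !mxE; ring.
Qed.

Lemma metric_nabla_xi (nabla : covderiv M)
    (hnabla : levi_civita g nabla)
    (alpha beta : M -> R) (htS : trans_sasakian S nabla alpha beta)
    (e : 'I_n -> vfield M)
    (he : orthonormal_frame_on g setT e) p (v : tangent p) :
  g p (nabla p v xi) v = beta p * (g p v v - eta p v ^+ 2).
Proof.
rewrite (nabla_xi_tangent hnabla htS he) linearDl !linearZl_LR metric_phi_self.
rewrite mulr0 add0r linearBl linearZl_LR.
by rewrite (Defs.metric_sym g (xi p)) metric_xi expr2.
Qed.

(** The terms mixing e1 and e2 form the imaginary part of rho, the twist; the factor 1/2 is the
    square of the normalisation 1/sqrt 2. *)
Lemma np_expansion_metric (nabla : covderiv M) (hnabla : levi_civita g nabla)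
    (e1 e2 : vfield M) p :
  np_expansion S nabla e1 e2 p
  = 2^-1 * (g p (nabla p (e1 p) xi) (e1 p) + g p (nabla p (e2 p) xi) (e2 p)).
Proof.
have nablaP := conn_linear (lc_connection hnabla) (acm_xi_smooth S).
have nabla0 := nabla_tangent0 (lc_connection hnabla) (acm_xi_smooth S) p.
have nablaZ a w : nabla p (a *: w) xi = a *: nabla p w xi.
  by rewrite -[a *: w]addr0 nablaP nabla0 addr0.
have gZZ (a b : R) (u w : tangent p) :
    g p (a *: u) (b *: w) = a * b * g p u w.
  by rewrite linearZl_LR -mulrA; congr (a * _); exact: linearZr_LR.
rewrite /np_expansion /np_rho /np_d /np_dbar /cnabla /cmetric /cscale /cvec /=.
rewrite !(scaler0, scale0r, scale1r, subr0, sub0r, addr0, add0r, oppr0).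
rewrite !nablaZ !gZZ linearNl.
rewrite -expr2 exprVn sqr_sqrtr // -!(Defs.metric_sym g (nabla _ _ _)).
by ring.
Qed.

End AlmostContact.

Theorem theorem5p16 (R : realType) (M : smooth_manifold R 3)
    (S : almost_contact_metric M) (nabla : covderiv M)
    (hnabla : levi_civita (acm_metric S) nabla)
    (alpha beta : M -> R) (htS : trans_sasakian S nabla alpha beta)
    (e1 e2 : vfield M) (hframe : np_frame S e1 e2) :
  (divergence_free (acm_metric S) nabla (acm_xi S)
     <-> non_expanding S nabla e1 e2) /\
  (non_expanding S nabla e1 e2 <-> C6_manifold S nabla alpha beta).
Proof.
have he := np_orthonormal hframe.
have [_ eo] := he.
have nxi := metric_nabla_xi hnabla htS he.
have g11 p : acm_metric S p (e1 p) (e1 p) = 1 by have := eo p I 0 0.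
have g22 p : acm_metric S p (e2 p) (e2 p) = 1 by have := eo p I 1 1.
have eta1 p : acm_eta S p (e1 p) = 0.
  by rewrite -metric_xi; have := eo p I 0 2.
have eta2 p : acm_eta S p (e2 p) = 0.
  by rewrite -metric_xi; have := eo p I 1 2.
have expE p : np_expansion S nabla e1 e2 p = beta p.
  rewrite np_expansion_metric // !nxi g11 g22 eta1 eta2 expr0n subr0 mulr1.
  by field.
have beta0P : non_expanding S nabla e1 e2 <-> forall p, beta p = 0.
  by split=> b0 p; have := b0 p; rewrite expE.
(* The trans-Sasakian half of the C6 condition is the hypothesis [htS], so only the vanishing of
   beta is at stake. *)
split; last by rewrite beta0P; split=> [|[]].
rewrite beta0P; split=> [div0 p | beta0 U e _ _ p _]; last first.
  by rewrite /divergence big1 // => i _; rewrite nxi beta0 mul0r.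
(* Test the divergence on the Newman-Penrose frame itself: e1 and e2 contribute beta each, and xi
   contributes beta (1 - 1) = 0. *)
have := div0 setT _ openT he p I.
rewrite /divergence !big_ord_recr big_ord0 /= !nxi /= !(tnth_nth e1) /=.
rewrite g11 g22 eta1 eta2 metric_xi acm_eta_xi expr0n expr1n subrr subr0 mulr0.
rewrite add0r addr0 mulr1 -mulr2n => /eqP.
by rewrite mulrn_eq0 => /eqP.
Qed.
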